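(* Let $d\ge 1$ and $n\ge 1$ be integers, and let $Q(d,n)$ denote the maximum integer $q$ such that in every antipodal $n$-fold cover of $S^d$ with open sets there exists a point of $S^d$ that is covered by at least $q$ sets of the cover. Then \[\left\lceil \tfrac{d}{2}\right\rceil + n \le Q(d,n) \le d+n.\]
   Context: $S^d$ denotes the $d$-dimensional unit sphere in $\mathbb{R}^{d+1}$ centered at the origin. A cover of $S^d$ is a (finite) family of subsets of $S^d$; it is an $n$-fold cover if every point of $S^d$ belongs to at least $n$ of the sets. A cover is antipodal if none of its sets contains a pair of antipodal points $x,-x$. A point is covered $k$ times if it belongs to $k$ sets of the cover. *)

(* Defs.v *)
From HB Require Import structures.
From mathcomp Require Import all_boot all_order all_algebra.
From mathcomp Require Import Rstruct.
Set Implicit Arguments. Unset Strict Implicit. Unset Printing Implicit Defensive.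
Import Order.TTheory GRing.Theory Num.Theory.
Local Open Scope ring_scope.

Definition pt (d : nat) := 'rV[Rdefinitions.R]_(d.+1).

Definition sqnorm (d : nat) (x : pt d) : Rdefinitions.R := \sum_(i < d.+1) (x 0 i) ^+ 2.

Definition on_sphere (d : nat) (x : pt d) : Prop := sqnorm x = 1.

(* U is a subset of S^d which is open in S^d (subspace topology of the
   Euclidean topology; the radius e is a squared radius). *)
Definition sphere_open (d : nat) (U : pt d -> Prop) : Prop :=
  (forall x, U x -> on_sphere x) /\
  (forall x, U x -> exists e : Rdefinitions.R, 0 < e /\
     forall y, on_sphere y -> sqnorm (y - x) < e -> U y).

Definition no_antipodal (d : nat) (U : pt d -> Prop) : Prop :=
  forall x, ~ (U x /\ U (- x)).

Definition covered_at_least (d k : nat) (U : 'I_k -> pt d -> Prop)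
  (x : pt d) (q : nat) : Prop :=
  exists S : {set 'I_k}, (q <= #|S|)%N /\ forall i, i \in S -> U i x.

Definition antipodal_open_nfold_cover (d n k : nat) (U : 'I_k -> pt d -> Prop)
  : Prop :=
  (forall i, sphere_open (U i)) /\
  (forall i, no_antipodal (U i)) /\
  (forall x, on_sphere x -> covered_at_least U x n).

Definition forces_multiplicity (d n q : nat) : Prop :=
  forall (k : nat) (U : 'I_k -> pt d -> Prop),
    antipodal_open_nfold_cover n U ->
    exists x, on_sphere x /\ covered_at_least U x q.

Definition is_Q (d n q : nat) : Prop :=
  forces_multiplicity d n q /\ forall q', forces_multiplicity d n q' -> (q' <= q)%N.

(* Main.v *)
(** Upper bound (Gale): on the moment curve, the 2n+d open hemispheres
    [{x | (-1)^i p_x(i) > 0}], where [p_x] is the polynomial with coefficient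
    vector [x], contain every point at least [n] times, because a nonzero
    polynomial of degree at most [d] cannot alternate weakly in sign at [d+2]
    points.  Since [-x] is covered [n] times as well, [x] is covered at most
    [d+n] times.

    Lower bound (Ky Fan): label a point of S^d by the largest index of the sets
    that contain a small ball around it, and extend the labelling to the
    suspension S^(d+1), with positive labels on the upper half and negative ones
    on the lower half.  A fine antipodal triangulation of S^(d+1) has a simplex
    whose [d+2] labels alternate in sign when sorted by absolute value.  Half of
    its vertices, rounded up, have the sign of the first label; each label
    gives a set containing a common point, and the label of the first vertex
    comes with [n-1] further sets of smaller index. *)
Require Import Defs.
From mathcomp Require Import all_boot all_order all_algebra.
From mathcomp Require Import zify lra.
From mathcomp Require Import all_classical all_reals all_analysis.
From mathcomp Require Import Rstruct Rstruct_topology.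
Set Implicit Arguments. Unset Strict Implicit. Unset Printing Implicit Defensive.
Import Order.TTheory GRing.Theory Num.Theory.
Import numFieldNormedType.Exports.

(** * Chains modulo 2 and Fan's lemma *)

(* A chain modulo 2 is a list of simplices, a simplex the list of its vertices
   (the empty simplex included).  Two chains are identified when [ev g] agrees
   on them for every cochain [g]. *)
Definition ev (T : Type) (g : seq T -> bool) (c : seq (seq T)) :=
  \big[addb/false]_(s <- c) g s.

Lemma ev_map (T1 T2 : Type) (g : seq T2 -> bool) (f : seq T1 -> seq T2) c :
  ev g (map f c) = ev (g \o f) c.
Proof. exact: big_map. Qed.

Section Chains.
Variable T : eqType.
Implicit Types (s : seq T) (c : seq (seq T)) (g : seq T -> bool).

(** The complex is augmented: the only facet of a vertex is the empty simplex, which lets dimension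
    0 start the count in [fan]. *)
Fixpoint facets s := if s is x :: s' then s' :: map (cons x) (facets s') else [::].

Definition extend (f : seq T -> seq (seq T)) c := flatten (map f c).

Definition boundary := extend facets.

Lemma ev_cat g c1 c2 : ev g (c1 ++ c2) = ev g c1 (+) ev g c2.
Proof. exact: big_cat. Qed.

Lemma ev_cons g s c : ev g (s :: c) = g s (+) ev g c.
Proof. exact: big_cons. Qed.

Lemma ev_extend g f c : ev g (extend f c) = ev (fun s => ev g (f s)) c.
Proof. by rewrite /ev big_flatten big_map. Qed.

Lemma ev_addb g h c : ev (fun s => g s (+) h s) c = ev g c (+) ev h c.
Proof. exact: big_split. Qed.

Lemma eq_ev_in g h c : {in c, g =1 h} -> ev g c = ev h c.
Proof. by move=> gh; rewrite /ev !big_seq; apply: eq_bigr. Qed.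

Lemma eq_ev g h c : g =1 h -> ev g c = ev h c.
Proof. by move=> gh; apply: eq_ev_in => s _. Qed.

Lemma ev_has g c : ev g c -> exists2 s, s \in c & g s.
Proof.
move=> h; apply/hasP; apply: contraLR h => /hasPn h.
by rewrite (@eq_ev_in g (fun=> false)) ?/ev ?big1_eq // => s /h /negbTE.
Qed.

Lemma facets_size s t : t \in facets s -> size s = (size t).+1.
Proof.
elim: s t => [|x s ih] t //=; rewrite inE => /orP[/eqP-> //|/mapP[u us ->]] /=.
by rewrite (ih u us).
Qed.

Lemma facets_subseq s t : t \in facets s -> subseq t s.
Proof.
elim: s t => [|x s ih] t //=; rewrite inE => /orP[/eqP->|/mapP[u us ->]].
  exact: subseq_cons.
by rewrite /= eqxx ih.
Qed.

Lemma facets_sub s t : t \in facets s -> {subset t <= s}.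
Proof. by move/facets_subseq/mem_subseq. Qed.

Lemma ev_facets_cons g x s :
  ev g (facets (x :: s)) = g s (+) ev (g \o cons x) (facets s).
Proof. by rewrite /= ev_cons ev_map. Qed.

Lemma ev_boundary_cone g x c :
  ev g (boundary (map (cons x) c)) = ev g c (+) ev (g \o cons x) (boundary c).
Proof.
rewrite !ev_extend ev_map -ev_addb; apply: eq_ev => s /=.
by rewrite ev_cons ev_map.
Qed.

(** The facets of [x :: s] are [s] and the cone over the facets of [s]; by the cone formula both
    contribute the boundary of [s], which cancels. *)
Lemma ev_boundary_facets g s : ev g (boundary (facets s)) = false.
Proof.
elim: s g => [|x s ih] g; first by rewrite /boundary /extend /ev big_nil.
rewrite [facets _]/= [boundary _]/= ev_cat ev_boundary_cone ih addbF.
exact: addbb.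
Qed.

End Chains.

Lemma facets_map (T1 T2 : eqType) (f : T1 -> T2) s :
  facets (map f s) = map (map f) (facets s).
Proof. by elim: s => //= x s ->; rewrite -!map_comp. Qed.

Lemma extend_map (T1 T2 : eqType) (f : T1 -> T2) (F1 : seq T1 -> seq (seq T1)) F2 c :
  (forall s, F2 (map f s) = map (map f) (F1 s)) ->
  extend F2 (map (map f) c) = map (map f) (extend F1 c).
Proof. by move=> h; elim: c => //= s c ih; rewrite /extend /= map_cat -h -ih. Qed.

(** * Barycentric subdivision and the octahedral sphere, modulo 2 *)

Section Subdivision.
Local Open Scope ring_scope.
Variables (R : numFieldType) (V : lmodType R).
Implicit Types (s : seq V) (c : seq (seq V)) (g : seq V -> bool).

Definition barycenter s : V := (size s)%:R^-1 *: \sum_(x <- s) x.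

(** The fuel [n] is meant to be the number of vertices, since recursion on facets is not
    structural. *)
Fixpoint subdivide_rec n s :=
  if n is m.+1 then map (cons (barycenter s)) (extend (subdivide_rec m) (facets s))
  else [:: [::]].

Definition subdivide s := subdivide_rec (size s) s.

Lemma subdivide_cons x s : subdivide (x :: s) =
  map (cons (barycenter (x :: s))) (extend subdivide (facets (x :: s))).
Proof.
rewrite /subdivide [LHS]/=; congr (map _ (flatten _)).
by apply/eq_in_map => t ts; have /= [->] := @facets_size _ (x :: s) t ts.
Qed.

(** The boundary of a cone is its base plus the cone over the boundary of the base. Here the base is
    the subdivided boundary of [s]; by induction its own boundary is the subdivision of a double
    boundary, hence zero. *)
Lemma boundary_subdivide s g :
  ev g (boundary (subdivide s)) = ev g (extend subdivide (facets s)).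
Proof.
have [n] := ubnP (size s); elim: n s g => // n ih [|x s] g sn; first by [].
rewrite subdivide_cons ev_boundary_cone.
set h := _ \o _; rewrite [X in _ (+) X](_ : _ = false) ?addbF //.
rewrite ev_extend ev_extend.
transitivity (ev (fun t => ev (fun u => ev h (subdivide u)) (facets t)) (facets (x :: s))).
  apply: eq_ev_in => t ts; rewrite -ev_extend -[RHS]ev_extend; apply: ih.
  by rewrite -ltnS -(facets_size ts).
by rewrite -[LHS]ev_extend -/(boundary _) ev_boundary_facets.
Qed.

Lemma boundary_extend_subdivide c g :
  ev g (boundary (extend subdivide c)) = ev g (extend subdivide (boundary c)).
Proof.
rewrite !ev_extend; apply: eq_ev => s; rewrite -ev_extend -[RHS]ev_extend.
exact: boundary_subdivide.
Qed.

Definition subdivided m c := iter m (extend subdivide) c.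

Lemma ev_subdivided m g c1 c2 : (forall h, ev h c1 = ev h c2) ->
  ev g (subdivided m c1) = ev g (subdivided m c2).
Proof.
move=> e; elim: m g => [|m ih] g; first exact: e.
by rewrite /= !ev_extend ih.
Qed.

Lemma subdivided_cat m c1 c2 :
  subdivided m (c1 ++ c2) = subdivided m c1 ++ subdivided m c2.
Proof. by elim: m => //= m ->; rewrite /extend map_cat flatten_cat. Qed.

Lemma boundary_subdivided m g c :
  ev g (boundary (subdivided m c)) = ev g (subdivided m (boundary c)).
Proof.
elim: m g => [|m ih] g //=; rewrite boundary_extend_subdivide.
by rewrite ev_extend ih -ev_extend.
Qed.

Definition antipode c := map (map (fun x : V => - x)) c.

Lemma barycenter_opp s : barycenter (map (fun x : V => - x) s) = - barycenter s.
Proof. by rewrite /barycenter size_map big_map sumrN scalerN. Qed.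

Lemma subdivide_opp s :
  subdivide (map (fun x : V => - x) s) = antipode (subdivide s).
Proof.
rewrite /subdivide size_map; move: (size s) => n; elim: n s => //= n ih s.
rewrite barycenter_opp facets_map (extend_map _ ih) /antipode -!map_comp.
exact: eq_map.
Qed.

Lemma subdivided_antipode m c :
  subdivided m (antipode c) = antipode (subdivided m c).
Proof. by elim: m => //= m ->; rewrite (extend_map _ subdivide_opp). Qed.

Lemma antipodeK c : antipode (antipode c) = c.
Proof. by apply: mapK; apply: mapK; exact: opprK. Qed.

Section Octahedron.
Variable e : nat -> V.

(** The boundary of the cross-polytope on the first [j] axes, a sphere of dimension [j - 1]; for
    [j = 0] it is the empty simplex. *)
Fixpoint octahedron j := if j is i.+1 then
  let c := map (cons (e i)) (octahedron i) in c ++ antipode c else [:: [::]].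

Definition hemisphere j := map (cons (e j)) (octahedron j).

Lemma ev_antipode_octahedron g j :
  ev g (antipode (octahedron j)) = ev g (octahedron j).
Proof.
case: j => //= j; rewrite [antipode (_ ++ _)]map_cat -!/(antipode _) antipodeK.
by rewrite !ev_cat addbC.
Qed.

Lemma boundary_antipode c : boundary (antipode c) = antipode (boundary c).
Proof. by apply: extend_map => s; rewrite facets_map. Qed.

(** Each of the two halves is a cone with boundary the sphere one dimension lower, which is its own
    antipode; the two copies cancel. *)
Lemma boundary_octahedron g j : ev g (boundary (octahedron j)) = false.
Proof.
elim: j g => [|j ih] g; first by rewrite /boundary /extend /ev big_nil.
rewrite [octahedron _]/= [boundary (_ ++ _)]/boundary /extend map_cat flatten_cat.
rewrite -![flatten _]/(boundary _) boundary_antipode ev_cat ev_map.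
rewrite !ev_boundary_cone !ih !addbF -(ev_map g (map (fun x : V => - x))).
rewrite -/(antipode _) ev_antipode_octahedron.
exact: addbb.
Qed.

Lemma boundary_hemisphere g j :
  ev g (boundary (hemisphere j)) = ev g (octahedron j).
Proof. by rewrite ev_boundary_cone boundary_octahedron addbF. Qed.

End Octahedron.
End Subdivision.

(** * Alternating sign sequences *)

Fixpoint alternating b (s : seq bool) :=
  if s is c :: s' then (c == b) && alternating (~~ b) s' else true.

(** Deleting the last entry of a sequence alternating from [b], or the first of one alternating from
    [~~ b], is the only deletion that leaves one alternating from [b]. In a sequence that does not
    alternate, such a deletion must hit its single pair of equal neighbours, and either of the two
    will do: an even count. *)
Lemma alternating_facets b s :
  ev (alternating b) (facets s) = alternating b s (+) alternating (~~ b) s.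
Proof.
elim: s b => [|c s ih] b; first by rewrite /ev big_nil.
rewrite ev_facets_cons /= negbK.
have [->|cb] := eqVneq c b.
  have -> : (b == ~~ b) = false by case: (b).
  rewrite (@eq_ev _ _ (alternating (~~ b))) ?ih ?negbK; last first.
    by move=> t /=; rewrite eqxx.
  by rewrite addbC -addbA addbb.
have -> : c == ~~ b by case: (c) (b) cb => [] [].
rewrite (@eq_ev _ _ (fun=> false)) ?/ev ?big1_eq ?addbF // => t /=.
by rewrite (negbTE cb).
Qed.

(* Signed labels are coded by naturals: absolute value [c./2], positive if [odd c].
   Equal labels are neighbours after sorting, so an alternating list has none. *)
Definition sorted_alternating b (l : seq nat) :=
  alternating b (map odd (sort leq l)).

(** Turns the sum over facets into one that can be reordered. [rem] deletes a first occurrence,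
    which agrees with the true facet only up to permutation when entries repeat. *)
Lemma ev_facets_rem (T : eqType) (g : seq T -> bool) s :
  (forall s1 s2, perm_eq s1 s2 -> g s1 = g s2) ->
  ev g (facets s) = \big[addb/false]_(x <- s) g (rem x s).
Proof.
elim: s g => [|x s ih] g gP; first by rewrite /ev !big_nil.
rewrite ev_facets_cons big_cons /= eqxx ih => [|s1 s2 s12]; last first.
  by apply: gP; rewrite perm_cons.
congr addb; apply: eq_big_seq => y ys /=.
case: eqVneq => [->|//]; apply: gP.
by rewrite perm_sym; apply: perm_to_rem.
Qed.

Lemma perm_rem (T : eqType) (x : T) s1 s2 :
  perm_eq s1 s2 -> perm_eq (rem x s1) (rem x s2).
Proof.
move=> s12; have [x1|x1] := boolP (x \in s1); last first.
  by rewrite !rem_id // -(perm_mem s12).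
rewrite -(perm_cons x) -(permPl (perm_to_rem x1)) (permPl s12).
by apply: perm_to_rem; rewrite -(perm_mem s12).
Qed.

Lemma sorted_alternating_facets b l :
  ev (sorted_alternating b) (facets l) =
  sorted_alternating b l (+) sorted_alternating (~~ b) l.
Proof.
have sortP l1 l2 : perm_eq l1 l2 -> sort leq l1 = sort leq l2.
  by move/(perm_sortP leq_total leq_trans anti_leq).
have invP l1 l2 : perm_eq l1 l2 -> sorted_alternating b l1 = sorted_alternating b l2.
  by rewrite /sorted_alternating => /sortP ->.
rewrite /sorted_alternating -alternating_facets facets_map ev_map.
transitivity (ev (sorted_alternating b) (facets (sort leq l))); last first.
  apply: eq_ev_in => t ts; rewrite /= /sorted_alternating sorted_sort //.
    exact: leq_trans.
  by apply: subseq_sorted (facets_subseq ts) (sort_sorted leq_total l); exact: leq_trans.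
rewrite !ev_facets_rem // [RHS](perm_big l) ?perm_sort //=.
by apply: eq_bigr => x _; apply: invP; apply: perm_rem; rewrite perm_sym perm_sort.
Qed.

Lemma alternating_negb b s : alternating b (map negb s) = alternating (~~ b) s.
Proof. by elim: s b => //= c s ih b; rewrite ih; case: (c) (b) => [] []. Qed.

Section Fan.
Local Open Scope ring_scope.
Variables (R : numFieldType) (V : lmodType R) (e : nat -> V).
Variables (key : V -> nat) (sgn : V -> bool) (m d : nat).

Definition label (p : V) : nat := ((key p).*2 + sgn p)%N.

Hypothesis key_opp : forall j s p, (j <= d)%N ->
  s \in subdivided m (hemisphere e j) -> p \in s -> key (- p) = key p.
Hypothesis sgn_opp : forall j s p, (j <= d)%N ->
  s \in subdivided m (hemisphere e j) -> p \in s -> sgn (- p) = ~~ sgn p.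
Hypothesis not_complementary : forall j s p q, (j <= d)%N ->
  s \in subdivided m (hemisphere e j) -> p \in s -> q \in s ->
  key p = key q -> sgn p = sgn q.

(** Changing the sign of a label flips its low bit. This is monotone on the labels of one simplex
    because no two of them are complementary, so it commutes with sorting. *)
Lemma sorted_alternating_opp b j s : (j <= d)%N ->
  s \in subdivided m (hemisphere e j) ->
  sorted_alternating b (map label (map (fun p : V => - p) s)) =
  sorted_alternating (~~ b) (map label s).
Proof.
move=> jd sj; rewrite /sorted_alternating -alternating_negb.
pose flip c := (c./2.*2 + ~~ odd c)%N.
have -> : map label (map (fun p : V => - p) s) = map flip (map label s).
  rewrite -!map_comp; apply/eq_in_map => p ps /=.
  rewrite /label /flip (key_opp jd sj ps) (sgn_opp jd sj ps).
  by case: (sgn p) => /=; lia.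
set l := map label s.
have -> : sort leq (map flip l) = map flip (sort leq l).
  apply: (sorted_eq leq_trans anti_leq); first exact: sort_sorted leq_total _.
    rewrite sorted_map; apply: (@sub_in_sorted _ (mem l) leq); last first.
    - exact: sort_sorted leq_total _.
    - by apply/allP => c; rewrite mem_sort.
    move=> _ _ /mapP[p ps ->] /mapP[q qs ->] /=.
    have := not_complementary jd sj ps qs.
    by rewrite /flip /label; case: (sgn p); case: (sgn q); lia.
  by rewrite perm_sort perm_map // perm_sym perm_sort.
rewrite -!map_comp; congr (alternating b _); apply: eq_map => c /=.
by rewrite /flip oddD odd_double; case: (odd c).
Qed.

(* Let [a_j] be the parity of the number of alternating simplices, of either
   starting sign, in the subdivided [j]-dimensional hemisphere.  Summing
   [sorted_alternating_facets] over that hemisphere gives [a_j] as the number of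
   positive alternating simplices on its boundary, two antipodal copies of the
   hemisphere one dimension lower; hence [a_j = a_(j-1)]. *)
Lemma fan : exists b s,
  s \in subdivided m (hemisphere e d) /\ sorted_alternating b (map label s).
Proof.
pose A b s := sorted_alternating b (map label s).
pose C j := subdivided m (hemisphere e j).
have facetsA b c : ev (A b) (boundary c) = ev (A b) c (+) ev (A (~~ b)) c.
  rewrite ev_extend -ev_addb; apply: eq_ev => s.
  by rewrite -sorted_alternating_facets facets_map ev_map.
have odd_count j : (j <= d)%N -> ev (A true) (C j) (+) ev (A false) (C j).
  elim: j => [|j ih] jd; rewrite -facetsA boundary_subdivided.
    (* In dimension 0 the boundary is the empty simplex, vacuously alternating, so the count is
       1. *)
    rewrite (ev_subdivided _ _ (boundary_hemisphere e ^~ 0)).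
    suff -> : subdivided m (octahedron e 0) = [:: [::]] by rewrite ev_cons /ev big_nil.
    by elim: (m) => //= n ->.
  rewrite (ev_subdivided _ _ (boundary_hemisphere e ^~ j.+1)).
  rewrite subdivided_cat ev_cat subdivided_antipode ev_map.
  (* Positive alternating simplices of the antipodal copy are negative ones of the original. *)
  rewrite [X in _ (+) X](@eq_ev_in _ _ (A false)); first exact/ih/ltnW.
  by move=> s sC; rewrite /= /A (sorted_alternating_opp _ (ltnW jd) sC).
have := odd_count d (leqnn d).
case: (boolP (ev (A true) (C d))) => [/ev_has[s sC As] _|_ /ev_has[s sC As]].
  by exists true, s.
by exists false, s.
Qed.

End Fan.

(** * Subdivisions of the cross-polytope *)

Lemma extendP (T : eqType) (f : seq T -> seq (seq T)) c t :
  reflect (exists2 s, s \in c & t \in f s) (t \in extend f c).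
Proof. exact: flatten_mapP. Qed.

Section SubdivisionInvariants.
Local Open Scope ring_scope.
Variables (R : numFieldType) (V : lmodType R).
Implicit Types (s t : seq V) (P : V -> Prop).

(** A weak convexity, just enough to pass from a simplex to all vertices of its subdivisions. *)
Definition barycentric P :=
  forall s, s != [::] -> (forall x, x \in s -> P x) -> P (barycenter s).

Lemma subdivide_barycentric P s t : barycentric P ->
  (forall x, x \in s -> P x) -> t \in subdivide s -> forall x, x \in t -> P x.
Proof.
move=> Pb; have [n] := ubnP (size s); elim: n s t => // n ih [|y s] t sn Ps.
  by rewrite inE => /eqP->.
rewrite subdivide_cons => /mapP[u /extendP[f fs uf] ->] x.
rewrite inE => /orP[/eqP->|xu]; first exact: Pb.
apply: ih uf x xu => [|x xf]; first by rewrite -ltnS -(facets_size fs).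
exact/Ps/(facets_sub fs).
Qed.

Lemma size_subdivide s t : t \in subdivide s -> size t = size s.
Proof.
have [n] := ubnP (size s); elim: n s t => // n ih [|y s] t sn.
  by rewrite inE => /eqP->.
rewrite subdivide_cons => /mapP[u /extendP[f fs uf] ->] /=.
by rewrite (ih _ _ _ uf) -(facets_size fs).
Qed.

Variable e : nat -> V.

(** A single [eps] serves all vertices, so a simplex never contains opposite points and lies in one
    closed orthant. *)
Lemma octahedron_vertices j s : s \in octahedron e j ->
  size s = j /\ exists eps : nat -> bool, forall p, p \in s ->
    exists2 i, (i < j)%N & p = (-1) ^+ eps i *: e i.
Proof.
elim: j s => [|j ih] s; first by rewrite inE => /eqP->; split=> //; exists xpredT.
have cone u : u \in map (cons (e j)) (octahedron e j) ->
    size u = j.+1 /\ exists eps : nat -> bool, forall p, p \in u ->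
    exists2 i, (i < j.+1)%N & p = (-1) ^+ eps i *: e i.
  case/mapP => t /ih [szt [eps epsP]] ->; split; first by rewrite /= szt.
  exists (fun i => if i == j then false else eps i) => p; rewrite inE.
  case/orP=> [/eqP->|/epsP[i ij ->]]; first by exists j; rewrite ?eqxx ?scale1r.
  by exists i; rewrite ?ltn_eqF // ltnW.
rewrite [octahedron _ _]/= mem_cat => /orP[/cone //|/mapP[u /cone[su [eps epsP]] ->]].
split; first by rewrite size_map.
exists (fun i => ~~ eps i) => _ /mapP[q /epsP[i ij ->] ->]; exists i => //.
by rewrite signrN scaleNr.
Qed.

Lemma hemisphere_vertices j s : s \in hemisphere e j ->
  size s = j.+1 /\ exists eps : nat -> bool, forall p, p \in s ->
    exists2 i, (i <= j)%N & p = (-1) ^+ eps i *: e i.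
Proof.
by move=> sh; apply: octahedron_vertices; rewrite [octahedron _ _]/= mem_cat sh.
Qed.

End SubdivisionInvariants.

Section Mesh.
Local Open Scope ring_scope.
Variables (R : realType) (V : normedModType R).
Implicit Types (s t : seq V).

Definition diam_le s (M : R) := forall p q, p \in s -> q \in s -> `|p - q| <= M.

Lemma norm_sub_barycenter p s : s != [::] ->
  `|p - barycenter s| <= (size s)%:R^-1 * \sum_(x <- s) `|p - x|.
Proof.
move=> s0; have n0 : (size s)%:R != 0 :> R by rewrite pnatr_eq0 size_eq0.
have -> : p - barycenter s = (size s)%:R^-1 *: \sum_(x <- s) (p - x).
  rewrite sumrB big_const_seq count_predT iter_addr_0 scalerBr -[p *+ _]scaler_nat scalerA.
  by rewrite mulVf // scale1r.
by rewrite normrZ ger0_norm ?invr_ge0 ?ler0n // ler_wpM2l ?invr_ge0 ?ler0n // ler_norm_sum.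
Qed.

Lemma closed_ball_barycentric p (r : R) : barycentric (fun x : V => `|p - x| <= r).
Proof.
move=> s s0 sr; apply: le_trans (norm_sub_barycenter p s0) _.
rewrite ler_pdivrMl ?ltr0n ?lt0n ?size_eq0 // mulr_natl.
rewrite -[X in _ <= r *+ X](count_predT s) -iter_addr_0 -big_const_seq.
rewrite big_seq [leRHS]big_seq; exact: ler_sum.
Qed.

Definition mesh_ratio d : R := d%:R / d.+1%:R.

(** Among [k <= d + 1] points, each is at distance at most [(k - 1) / k * M] from the barycenter,
    since it contributes 0 to the average of distances. The remaining vertices come from a facet, by
    induction. *)
Lemma diam_subdivide d s t M : 0 <= M -> (size s <= d.+1)%N ->
  diam_le s M -> t \in subdivide s -> diam_le t (mesh_ratio d * M).
Proof.
move=> M0; have [n] := ubnP (size s); elim: n s t => // n ih [|y s] t sn sd sM.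
  by rewrite inE => /eqP->.
set s' := y :: s in sd sM *.
rewrite subdivide_cons -/s' => /mapP[u uC ->].
have [f fs uf] := extendP _ _ _ uC.
have r0 : 0 <= mesh_ratio d by rewrite divr_ge0.
have vertex q : q \in s' -> `|barycenter s' - q| <= mesh_ratio d * M.
  move=> qs; rewrite distrC; apply: le_trans (norm_sub_barycenter q _) _ => //.
  rewrite ler_pdivrMl ?ltr0n // (perm_big _ (perm_to_rem qs)) big_cons subrr normr0 /= add0r.
  apply: (@le_trans _ _ ((size s)%:R * M)).
    rewrite mulr_natl -[size s](size_rem qs) -count_predT -iter_addr_0 -big_const_seq.
    rewrite big_seq [leRHS]big_seq; apply: ler_sum => x /(@mem_rem _ q s') xs.
    exact: sM.
  rewrite mulrA ler_wpM2r // /mesh_ratio mulrA ler_pdivlMr ?ltr0n // -!natrM ler_nat.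
  by move: sd; rewrite /=; nia.
have inner q : q \in u -> `|barycenter s' - q| <= mesh_ratio d * M.
  apply: (subdivide_barycentric (@closed_ball_barycentric _ _)) uf q => x xf.
  exact/vertex/(facets_sub fs).
have uM : diam_le u (mesh_ratio d * M).
  apply: ih uf; first by rewrite -ltnS -(facets_size fs).
    by rewrite -ltnS -(facets_size fs) ltnW.
  by move=> p q pf qf; apply: sM; exact: (facets_sub fs).
move=> p q; rewrite !inE => /orP[/eqP->|pu] /orP[/eqP->|qu].
- by rewrite subrr normr0 mulr_ge0.
- exact: inner.
- by rewrite distrC; exact: inner.
- exact: uM.
Qed.

(** [P] is quantified after [s] because it will be [in_face eps], whose signs depend on the original
    simplex. *)
Lemma subdivided_invariants d m c t M : 0 <= M ->
  t \in subdivided m c -> exists s, [/\ s \in c, size t = size s,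
    forall P : V -> Prop, barycentric P -> (forall x, x \in s -> P x) ->
      forall x, x \in t -> P x &
    (size s <= d.+1)%N -> diam_le s M -> diam_le t (mesh_ratio d ^+ m * M)].
Proof.
move=> M0; elim: m t => [|m ih] t; first by exists t; split=> // _; rewrite mul1r.
rewrite [subdivided _ _]/= => /extendP[u /ih[s [sc us uP uM]] tu].
exists s; split=> //; first by rewrite (size_subdivide tu).
- by move=> P Pb Ps x; apply: (subdivide_barycentric Pb _ tu) => y; exact: uP.
- move=> sd sM; rewrite exprS -mulrA; apply: diam_subdivide tu; last exact: uM.
  + by rewrite mulr_ge0 // exprn_ge0 // divr_ge0.
  + by rewrite us.
Qed.

End Mesh.

Section CrossPolytope.
Local Open Scope ring_scope.
Variables (R : realType) (d : nat).
Notation V := 'rV[R]_d.+1.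

Definition axis (i : nat) : V := delta_mx 0 (inord i).

Definition l1norm (p : V) : R := \sum_i `|p 0 i|.

(** The facet of the cross-polytope in the orthant [eps]: unlike the whole l1 unit sphere, it is
    closed under barycenters. *)
Definition in_face (eps : nat -> bool) (p : V) :=
  (forall i : 'I_d.+1, 0 <= (-1) ^+ eps i * p 0 i) /\
  \sum_(i < d.+1) (-1) ^+ eps i * p 0 i = 1.

Lemma in_face_barycentric eps : barycentric (in_face eps).
Proof.
move=> s s0 sP; have n0 : (size s)%:R != 0 :> R by rewrite pnatr_eq0 size_eq0.
have E i : (barycenter s) 0 i = (size s)%:R^-1 * \sum_(x <- s) x 0 i.
  by rewrite !mxE; congr (_ * _); elim/big_ind2: _ => [|? ? ? ? <- <-|//]; rewrite mxE.
split=> [i|].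
  rewrite E mulrCA mulr_ge0 ?invr_ge0 ?ler0n // mulr_sumr big_seq sumr_ge0 // => x xs.
  by have [] := sP x xs.
under eq_bigr do rewrite E mulrCA mulr_sumr.
rewrite -mulr_sumr exchange_big /= big_seq (eq_bigr (fun=> 1)); last first.
  by move=> x xs; have [] := sP x xs.
by rewrite -big_seq big_const_seq count_predT iter_addr_0 mulVf.
Qed.

Lemma in_face_axis eps i : (i <= d)%N -> in_face eps ((-1) ^+ eps i *: axis i).
Proof.
move=> id.
have E (k : 'I_d.+1) : (-1) ^+ eps k * ((-1) ^+ eps i *: axis i) 0 k = (k == inord i)%:R.
  rewrite !mxE /=; case: eqVneq => [->|_]; last by rewrite !mulr0.
  by rewrite inordK ?ltnS // mulr1 -expr2 sqrr_sign.
split=> [k|]; first by rewrite E.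
rewrite (eq_bigr _ (fun k _ => E k)) (bigD1 (inord i)) //= eqxx big1 ?addr0 //.
by move=> k /negbTE ->.
Qed.

Lemma in_face_l1norm eps p : in_face eps p -> l1norm p = 1.
Proof.
move=> [p0 <-]; apply: eq_bigr => i _.
by rewrite -[RHS]ger0_norm // normrMsign.
Qed.

Lemma norm_le_l1norm p : `|p| <= l1norm p.
Proof.
rewrite [`|p|]mx_normrE; apply/bigmax_leP; split=> [|[i j] _ /=].
  exact: sumr_ge0.
by rewrite ord1 /l1norm (bigD1 j) //= lerDl sumr_ge0.
Qed.

Lemma fine_hemisphere (eta : R) : 0 < eta -> exists m, forall j s, (j <= d)%N ->
  s \in subdivided m (hemisphere axis j) ->
  [/\ size s = j.+1, forall p, p \in s -> l1norm p = 1 & diam_le s eta].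
Proof.
move=> eta0.
(* The factor 2 bounds the diameter before subdivision: the sup norm is at most the l1 norm, which
   is 1 on all vertices. *)
have [m rm] : exists m, mesh_ratio R d ^+ m * 2 <= eta.
  have r0 : 0 <= mesh_ratio R d by rewrite divr_ge0.
  have r1 : `|mesh_ratio R d| < 1.
    by rewrite ger0_norm // ltr_pdivrMr ?ltr0n // mul1r ltr_nat.
  have /cvgrPdist_lt/(_ (eta / 2)) := cvg_expr r1.
  case=> [|m _ /(_ m (leqnn m))]; first by rewrite divr_gt0.
  rewrite /= sub0r normrN ger0_norm ?exprn_ge0 // => h; exists m.
  by rewrite -ler_pdivlMr // ltW.
exists m => j s jd sm.
have [s0 [s0h ss0 sP sM]] := @subdivided_invariants R V d m _ s 2 (ler0n _ _) sm.
have [szs0 [eps epsP]] := hemisphere_vertices s0h.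
have vertex p : p \in s0 -> in_face eps p.
  by case/epsP => i ij ->; apply: in_face_axis; apply: leq_trans ij jd.
have face := sP _ (@in_face_barycentric eps) vertex.
split.
- by rewrite ss0.
- by move=> p /face /in_face_l1norm.
- move=> p q ps qs; apply: le_trans rm; apply: sM => //; first by rewrite szs0.
  move=> x y /vertex/in_face_l1norm x1 /vertex/in_face_l1norm y1.
  apply: le_trans (ler_normB _ _) _.
  by apply: lerD; [rewrite -x1|rewrite -y1]; exact: norm_le_l1norm.
Qed.

End CrossPolytope.

(** * The lower bound *)

Section Lebesgue.
Local Open Scope ring_scope.
Local Open Scope classical_set_scope.
Variables (R : realType) (X : normedModType R) (I : finType) (V : I -> set X).

(** Half of a radius that works at [x] works throughout a neighbourhood of [x]; compactness makes
    the radius uniform. *)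
Lemma lebesgue_number (K : set X) n : compact K ->
  (forall x, K x -> exists2 S : {set I}, (n <= #|S|)%N & forall i, i \in S -> nbhs x (V i)) ->
  exists2 delta : R, 0 < delta & forall x, K x ->
    exists2 S : {set I}, (n <= #|S|)%N &
      forall i, i \in S -> forall y, `|x - y| < delta -> V i y.
Proof.
move=> /compact_near_coveringP Kc cover.
pose P (delta : R) (x : X) := exists2 S : {set I}, (n <= #|S|)%N &
      forall i, i \in S -> forall y, `|x - y| < delta -> V i y.
have H : \forall delta \near (0 : R)^'+, K `<=` P delta.
  apply: Kc => x /cover[S nS SV].
  have [eps eps0 epsV] : exists2 eps : R, 0 < eps &
      forall i, i \in S -> forall y, `|x - y| < eps -> V i y.
    have : \forall eps \near (0 : R)^'+, forall i, i \in S ->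
        forall y, `|x - y| < eps -> V i y.
      apply: filter_forall => i; have [iS|_] := boolP (i \in S); last exact: nearW.
      have /nbhs_normP[e /= e0 eV] := SV i iS.
      near=> eps => _ y xy; apply: eV; apply: lt_trans xy _.
      by near: eps; exact: nbhs_right_lt.
    move=> h; near (0 : R)^'+ => eps; exists eps => //.
    by near: eps.
  have e2 : 0 < eps / 2 by rewrite divr_gt0.
  near=> x' delta.
  have xx' : `|x - x'| < eps / 2 by near: x'; apply: cvgr_dist_lt.
  have d2 : delta < eps / 2 by near: delta; exact: nbhs_right_lt.
  exists S => // i iS y xy; apply: (epsV i iS).
  have -> : x - y = (x - x') + (x' - y) by rewrite addrA subrK.
  apply: le_lt_trans (ler_normD _ _) _; rewrite [ltRHS](splitr eps); apply: ltrD => //.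
  exact: lt_trans xy _.
near (0 : R)^'+ => delta; exists delta => // x Kx.
by have : K `<=` P delta; [near: delta|exact].
Unshelve. all: by end_near.
Qed.

End Lebesgue.

Section Normalize.
Local Open Scope ring_scope.
Local Open Scope classical_set_scope.
Variables (R : realType) (n : nat).
Implicit Types x y : 'rV[R]_n.

Definition sqsum x : R := \sum_i x 0 i ^+ 2.

Definition normalize x : 'rV[R]_n := (Num.sqrt (sqsum x))^-1 *: x.

Lemma sqsumN x : sqsum (- x) = sqsum x.
Proof. by apply: eq_bigr => i _; rewrite mxE sqrrN. Qed.

Lemma sqsumZ a x : sqsum (a *: x) = a ^+ 2 * sqsum x.
Proof. by rewrite mulr_sumr; apply: eq_bigr => i _; rewrite mxE exprMn. Qed.

Lemma sqsum_ge0 x : 0 <= sqsum x.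
Proof. by apply: sumr_ge0 => i _; exact: sqr_ge0. Qed.

Lemma sqsum_gt0 x : x != 0 -> 0 < sqsum x.
Proof.
move=> x0; rewrite lt_neqAle sqsum_ge0 andbT eq_sym; apply: contraNN x0.
rewrite psumr_eq0 => [/allP x0|i _]; last exact: sqr_ge0.
apply/eqP/rowP => i; rewrite mxE; apply/eqP.
by rewrite -sqrf_eq0; apply: x0; rewrite mem_index_enum.
Qed.

Lemma normalizeN x : normalize (- x) = - normalize x.
Proof. by rewrite /normalize sqsumN scalerN. Qed.

Lemma sqsum_normalize x : x != 0 -> sqsum (normalize x) = 1.
Proof.
move=> /sqsum_gt0 x0; rewrite sqsumZ exprVn sqr_sqrtr ?sqsum_ge0 //.
by rewrite mulVf // gt_eqF.
Qed.

Lemma sqsum_continuous : continuous sqsum.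
Proof.
apply: continuous_big => [|i _ x]; first exact: add_continuous.
have c : (fun y : 'rV[R]_n => y 0 i) @ x --> x 0 i by exact: coord_continuous.
exact: (cvgM c c).
Qed.

Lemma normalize_continuous x : x != 0 -> {for x, continuous normalize}.
Proof.
move=> x0; have sx0 : Num.sqrt (sqsum x) != 0 by rewrite gt_eqF // sqrtr_gt0 sqsum_gt0.
have c : Num.sqrt (sqsum y) @[y --> x] --> Num.sqrt (sqsum x).
  apply: (continuous_comp (f := sqsum)); first exact: sqsum_continuous.
  exact: sqrt_continuous.
exact: (cvgZ (cvgV sx0 c) cvg_id).
Qed.

(** Bridges the squared Euclidean radius in [sphere_open] and the sup norm topology of row
    vectors. *)
Lemma nbhs_normalize x (e : R) : x != 0 -> 0 < e ->
  \forall y \near x, y != 0 /\ sqsum (normalize y - normalize x) < e.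
Proof.
move=> x0 e0.
have c : normalize y - normalize x @[y --> x] --> normalize x - normalize x.
  exact: (cvgB (normalize_continuous x0) (cvg_cst _)).
have c0 : sqsum (normalize y - normalize x) @[y --> x] --> sqsum (normalize x - normalize x).
  exact: (cvg_comp _ _ c (@sqsum_continuous _)).
have lt_e : sqsum (normalize x - normalize x) < e.
  by rewrite subrr /sqsum big1 // => i _; rewrite mxE expr0n.
have := cvgr_lt _ c0 _ lt_e; have : \forall y \near x, y != 0.
  exact: (@cvgr_neq0 _ _ _ (nbhs x) _ id x cvg_id x0).
by move=> n0 s0; apply: filterS2 n0 (s0 _) => y.
Qed.

End Normalize.

Lemma compact_annulus (R : realType) n (r : R) :
  compact [set x : 'rV[R]_n | r <= `|x| <= 1]%R%classic.
Proof.
apply: bounded_closed_compact.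
  exists 1%R; split; first exact: num_real.
  by move=> M M1 x /andP[_ x1]; apply: le_trans x1 (ltW M1).
rewrite (_ : mkset _ = (fun x : 'rV[R]_n => `|x|%R) @^-1` `[r, 1%R])%classic.
  apply: closed_comp; last exact: interval_closed.
  by move=> x _; exact: norm_continuous.
by apply/seteqP; split=> x /=; rewrite in_itv.
Qed.

(** Keep every second entry after [a]. Neighbours have opposite parity, so the weak order between
    them is strict. *)
Lemma alternating_thin b a l : sorted leq (a :: l) ->
  alternating b (map odd (a :: l)) -> exists t, [/\ uniq t, size t = (size l)./2,
    {subset t <= l} & forall c, c \in t -> odd c = b /\ (a < c)%N].
Proof.
have [n] := ubnP (size l); elim: n a l => // n ih a [|c1 [|c2 l]] sl.
- by exists [::].
- by exists [::].
rewrite [sorted _ _]/= => /and3P[ac1 c12 sl2].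
rewrite /= negbK => /and4P[/eqP oa /eqP oc1 /eqP oc2 al].
have [|||t [ut st tl tP]] := ih c2 l.
- by move: sl => /=; lia.
- exact: sl2.
- by rewrite /= oc2 eqxx.
have c12' : (c1 < c2)%N.
  by rewrite ltn_neqAle c12 andbT; apply/eqP => c12'; move: oc1; rewrite c12' oc2; case: (b).
exists (c2 :: t); split=> /=.
- by rewrite ut andbT; apply/negP => /tP[_]; rewrite ltnn.
- by rewrite st.
- by move=> c; rewrite !inE => /orP[->|/tl ->]; rewrite ?orbT.
move=> c; rewrite inE => /orP[/eqP->|/tP[oc c2c]]; split=> //; first exact: leq_ltn_trans ac1 c12'.
by apply: ltn_trans c2c; exact: leq_ltn_trans ac1 c12'.
Qed.

Lemma ltn_half_odd a c : (a < c)%N -> odd a = odd c -> (a./2 < c./2)%N.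
Proof. by move=> ac; rewrite -(odd_double_half a) -(odd_double_half c) in ac * => E; lia. Qed.

(** The default on the empty set is 0, whence the nonemptiness conditions below. *)
Definition top_index k (T : {set 'I_k}) : nat := \max_(i in T) i.

Lemma top_indexP k (T : {set 'I_k}) : (0 < #|T|)%N ->
  exists2 i, i \in T & top_index T = i.
Proof. by move=> /(eq_bigmax_cond (fun i : 'I_k => i : nat))[i iT E]; exists i. Qed.

Lemma card_set_of_nats k (t : seq nat) : uniq t -> (forall c, c \in t -> c < k)%N ->
  #|[set i : 'I_k | (i : nat) \in t]| = size t.
Proof.
move=> ut tk; rewrite cardE -(size_map val); apply: perm_size.
apply: uniq_perm => //; first by rewrite map_inj_uniq ?enum_uniq //; exact: val_inj.
move=> c; apply/mapP/idP => [[i + ->]|ct]; first by rewrite mem_enum inE.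
by exists (Ordinal (tk _ ct)); rewrite // mem_enum inE.
Qed.

Lemma coord_norm_le (R : realType) n (x : 'rV[R]_n) i : (`|x 0 i| <= `|x|)%R.
Proof.
by rewrite [leRHS]mx_normrE; apply: (@le_bigmax _ _ _ _ (fun ij => `|x ij.1 ij.2|%R) (ord0, i)).
Qed.

(** * Labelling the suspension and applying Fan's lemma *)

Section LowerBound.
Local Open Scope ring_scope.
Local Open Scope classical_set_scope.
Notation R := Rdefinitions.R.
Variables (d n k : nat) (U : 'I_k -> pt d -> Prop).
Hypotheses (n0 : (0 < n)%N) (Ucover : antipodal_open_nfold_cover n U).

Definition cone (i : 'I_k) (x : pt d) : Prop := x != 0 /\ U i (normalize x).

Lemma cone_opp i x : cone i x -> ~ cone i (- x).
Proof.
case: Ucover => _ [anti _] [_ Ux] [_]; rewrite normalizeN => UNx.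
exact: (anti i (normalize x)).
Qed.

Lemma cone_nbhs i x : cone i x -> nbhs x (cone i).
Proof.
case: Ucover => Uopen _ [x0 Ux].
have [_ /(_ _ Ux)[e [e0 eU]]] := Uopen i.
apply: filterS (nbhs_normalize x0 e0) => y [y0 ye]; split=> //.
by apply: eU ye; exact: sqsum_normalize.
Qed.

Lemma lebesgue_cone (r : R) : 0 < r -> exists2 delta : R, 0 < delta &
  forall x : pt d, r <= `|x| <= 1 -> exists2 S : {set 'I_k}, (n <= #|S|)%N &
    forall i, i \in S -> forall y, `|x - y| < delta -> cone i y.
Proof.
move=> r0; apply: (lebesgue_number (compact_annulus (r := r))).
move=> x /andP[rx _].
have x0 : x != 0 by rewrite -normr_gt0; apply: lt_le_trans rx.
case: Ucover => _ [_ /(_ (normalize x))[|S [nS SU]]].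
  exact: sqsum_normalize.
by exists S => // i /SU Ux; apply: cone_nbhs.
Qed.

Definition deep (delta : R) (x : pt d) : {set 'I_k} :=
  [set i | `[< forall y, `|x - y| < delta -> cone i y >]].

Lemma deepP delta x i :
  reflect (forall y, `|x - y| < delta -> cone i y) (i \in deep delta x).
Proof. by rewrite inE; apply: asboolP. Qed.

Definition horizontal (p : 'rV[R]_d.+2) : pt d := \row_i p 0 (lift ord0 i).

(** The suspension direction is coordinate 0, unrelated to the apex [axis (d+1)] of the hemisphere
    used in [fan]. *)
Definition height (p : 'rV[R]_d.+2) : R := p 0 0.

Lemma horizontalN p : horizontal (- p) = - horizontal p.
Proof. by apply/rowP => i; rewrite !mxE. Qed.

Lemma norm_horizontalB p q : `|horizontal p - horizontal q| <= `|p - q|.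
Proof.
rewrite [leLHS]mx_normrE; apply/bigmax_leP; split=> // -[i j] _ /=.
rewrite ord1 !mxE; have -> : p 0 (lift ord0 j) - q 0 (lift ord0 j) = (p - q) 0 (lift ord0 j).
  by rewrite !mxE.
exact: (coord_norm_le (p - q)).
Qed.

Lemma norm_heightB p q : `|height p - height q| <= `|p - q|.
Proof.
have -> : height p - height q = (p - q) 0 0 by rewrite !mxE.
exact: (coord_norm_le (p - q)).
Qed.

(** If the height is at most 1/2, the other [d + 1] coordinates have absolute values of sum at least
    1/2, so the largest is at least this. *)
Definition half_dim : R := (2 * d.+1%:R)^-1.

Lemma half_dim_gt0 : 0 < half_dim.
Proof. by rewrite invr_gt0 mulr_gt0 ?ltr0n. Qed.

Lemma horizontal_annulus p : l1norm p = 1 -> `|height p| <= 2^-1 ->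
  half_dim <= `|horizontal p| <= 1.
Proof.
rewrite /l1norm big_ord_recl -/(height p) => p1 hp.
have E : \sum_(i < d.+1) `|p 0 (lift ord0 i)| = l1norm (horizontal p).
  by apply: eq_bigr => i _; rewrite mxE.
rewrite E in p1; apply/andP; split; last first.
  apply: le_trans (norm_le_l1norm _) _; rewrite -p1 lerDr; exact: normr_ge0.
have : l1norm (horizontal p) <= d.+1%:R * `|horizontal p|.
  rewrite mulr_natl -[X in _ *+ X]card_ord -sumr_const; apply: ler_sum => i _.
  exact: coord_norm_le.
have : 2^-1 <= l1norm (horizontal p) by lra.
move=> /le_trans h /h; rewrite /half_dim invfM ler_pdivrMr ?ltr0n //.
by rewrite [leRHS]mulrC.
Qed.

(** A common top index would give a set whose cone contains both [x] and [- x], the latter because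
    it is within [delta] of [- y]. *)
Lemma deep_disjoint delta x y : `|x - y| < delta ->
  top_index (deep delta x) = top_index (deep delta (- y)) ->
  (0 < #|deep delta x|)%N -> (0 < #|deep delta (- y)|)%N -> False.
Proof.
move=> xy E /top_indexP[i ix Ei] /top_indexP[j jy Ej].
have ij : i = j by apply: val_inj; rewrite /= -Ei E.
have delta0 : 0 < delta by apply: le_lt_trans xy.
apply: (@cone_opp i x).
  by move/deepP: ix; apply; rewrite subrr normr0.
move: jy; rewrite -ij => /deepP; apply.
by rewrite opprK addrC.
Qed.

Section Signs.
Variables (delta : R).

(* On the equator the sign has to be odd as well; comparing the labels of
   [x] and [-x], which differ, decides it. *)
Definition upper (p : 'rV[R]_d.+2) : bool :=
  (0 < height p) || ((height p == 0) &&
  (top_index (deep delta (horizontal p)) < top_index (deep delta (- horizontal p)))%N).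

Definition signed (b : bool) (x : pt d) := if b then x else - x.

Definition signed_index (p : 'rV[R]_d.+2) : nat :=
  top_index (deep delta (signed (upper p) (horizontal p))).

Lemma upper_height p : upper p -> 0 <= height p.
Proof. by case/orP => [/ltW //|/andP[/eqP-> _]]. Qed.

Lemma lower_height p : ~~ upper p -> height p <= 0.
Proof. by rewrite negb_or -leNgt => /andP[]. Qed.

Hypotheses (delta0 : 0 < delta) (deltaP : forall x : pt d,
  half_dim <= `|x| <= 1 -> (n <= #|deep delta x|)%N).

Lemma deep_nonempty b p : l1norm p = 1 -> `|height p| <= 2^-1 ->
  (n <= #|deep delta (signed b (horizontal p))|)%N.
Proof.
move=> p1 hp; apply: deltaP; have := horizontal_annulus p1 hp.
by case: b; rewrite ?normrN.
Qed.

Lemma upperN p : l1norm p = 1 -> upper (- p) = ~~ upper p.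
Proof.
move=> p1; rewrite /upper horizontalN opprK.
have -> : height (- p) = - height p by rewrite /height mxE.
rewrite oppr_gt0 oppr_eq0; case: ltrgt0P => //= hp.
rewrite -leqNgt [RHS]leq_eqVlt; case: eqP => [E|] //=.
have h2 : `|height p| <= 2^-1 by rewrite hp normr0 invr_ge0.
exfalso; apply: (@deep_disjoint delta (horizontal p) (horizontal p)).
- by rewrite subrr normr0.
- by rewrite E.
- exact: leq_trans n0 (deep_nonempty true p1 h2).
- exact: leq_trans n0 (deep_nonempty false p1 h2).
Qed.

Lemma signed_indexN p : l1norm p = 1 -> signed_index (- p) = signed_index p.
Proof.
by move=> p1; rewrite /signed_index upperN // horizontalN; case: upper; rewrite //= opprK.
Qed.

(** Close points of opposite sign have weakly opposite heights, hence lie in the belt of heights up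
    to 1/2, where the deep sets are nonempty and [deep_disjoint] applies. The default index near the
    poles is therefore harmless. *)
Lemma signed_index_compatible p q : l1norm p = 1 -> l1norm q = 1 ->
  `|p - q| < delta -> `|p - q| <= 2^-1 ->
  signed_index p = signed_index q -> upper p = upper q.
Proof.
have wlog_upper x y : l1norm x = 1 -> l1norm y = 1 ->
    `|x - y| < delta -> `|x - y| <= 2^-1 ->
    signed_index x = signed_index y -> upper x -> ~~ upper y -> False.
  move=> x1 y1 xy xy2 E ux uy.
  have hxy := le_trans (norm_heightB x y) xy2.
  have hx := upper_height ux; have hy := lower_height uy.
  have hx2 : `|height x| <= 2^-1 by move: hxy; rewrite !ler_norml; lra.
  have hy2 : `|height y| <= 2^-1 by move: hxy; rewrite !ler_norml; lra.
  move: E; rewrite /signed_index ux (negbTE uy) /= => E.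
  apply: deep_disjoint E _ _.
  - exact: le_lt_trans (norm_horizontalB x y) xy.
  - exact: leq_trans n0 (deep_nonempty true x1 hx2).
  - exact: leq_trans n0 (deep_nonempty false y1 hy2).
move=> p1 q1 pq pq2 E.
case: (boolP (upper p)) => up; case: (boolP (upper q)) => uq //.
  by case: (wlog_upper p q).
by case: (wlog_upper q p); rewrite // distrC.
Qed.

End Signs.

Theorem covered_lower_bound :
  exists x, on_sphere x /\ covered_at_least U x (d.+1 %/ 2 + n).
Proof.
have [delta delta0 deltaS] := lebesgue_cone half_dim_gt0.
have deltaP (x : pt d) : half_dim <= `|x| <= 1 -> (n <= #|deep delta x|)%N.
  move=> /deltaS[S nS SV]; apply: leq_trans nS _; apply: subset_leq_card.
  by apply/fintype.subsetP => i /SV h; apply/deepP.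
(* [delta / 2] makes the mesh strictly less than [delta]; [1/2] keeps simplices with both signs in
   the belt around the equator. *)
pose eta := Num.min (delta / 2) 2^-1.
have eta0 : 0 < eta by rewrite lt_min !divr_gt0 //= invr_gt0.
have eta_delta : eta < delta by rewrite gt_min; apply/orP; left; lra.
have eta2 : eta <= 2^-1 by rewrite ge_min lexx orbT.
have [m mP] := @fine_hemisphere R d.+1 eta eta0.
have [|||b [s [sm sb]]] :=
    @fan R _ (axis R d.+1) (signed_index delta) (upper delta) m d.+1.
- move=> j s p jd sj ps; have [_ s1 _] := mP j s jd sj.
  exact: signed_indexN (s1 p ps).
- move=> j s p jd sj ps; have [_ s1 _] := mP j s jd sj.
  exact: upperN (s1 p ps).
- move=> j s p q jd sj ps qs; have [_ s1 se] := mP j s jd sj.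
  apply: signed_index_compatible (s1 p ps) (s1 q qs) _ _ => //.
    exact: le_lt_trans (se p q ps qs) _.
  exact: le_trans (se p q ps qs) _.
have [ssz s1 se] := mP _ s (leqnn _) sm.
pose lab := label (signed_index delta) (upper delta).
have odd_lab p : odd (lab p) = upper delta p by rewrite oddD odd_double; case: upper.
have half_lab p : (lab p)./2 = signed_index delta p.
  by rewrite /lab /label addnC half_bit_double.
have lab_mem c : c \in sort leq (map lab s) -> exists2 p, p \in s & c = lab p.
  by rewrite mem_sort => /mapP.
have lsz : size (sort leq (map lab s)) = d.+2 by rewrite size_sort size_map.
move: sb; rewrite /sorted_alternating -/lab.
have := sort_sorted leq_total (map lab s).
case El : (sort leq (map lab s)) lsz => [|a [|c1 l]] // [szl] sl al.
have [t [ut st tl tP]] := alternating_thin sl al.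
have [pa pas Ea] : exists2 p, p \in s & a = lab p by apply: lab_mem; rewrite El inE eqxx.
have [p1 p1s E1] : exists2 p, p \in s & c1 = lab p.
  by apply: lab_mem; rewrite El !inE eqxx orbT.
have /= /and3P[/eqP oa /eqP oc1 _] := al.
rewrite Ea odd_lab in oa; rewrite E1 odd_lab in oc1.
(* The first two labels have opposite signs, so the simplex has vertices of both weak signs of
   height, and its diameter is at most 1/2. *)
have height2 p : p \in s -> `|height p| <= 2^-1.
  move=> ps.
  have ha := le_trans (norm_heightB p pa) (le_trans (se _ _ ps pas) eta2).
  have h1 := le_trans (norm_heightB p p1) (le_trans (se _ _ ps p1s) eta2).
  move: ha h1; rewrite !ler_norml.
  case: (boolP (upper delta pa)) oc1 oa => ua oc1 oa.
    have := upper_height ua; have := @lower_height delta p1; rewrite oc1 -oa.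
    by move=> /(_ isT); lra.
  have := lower_height ua; have := @upper_height delta p1; rewrite oc1 -oa.
  by move=> /(_ isT); lra.
pose y := signed b (horizontal pa).
have cone_y p i : p \in s -> i \in deep delta (signed b (horizontal p)) -> cone i y.
  move=> ps /deepP; apply; apply: le_lt_trans eta_delta; apply: le_trans (se p pa ps pas).
  apply: le_trans (norm_horizontalB p pa); rewrite /y; case: (b) => //=.
  by rewrite -opprD normrN.
(* Indices in [S0] are at most [a./2], the top index at [y]; those in [S1] come from later labels of
   the same sign and exceed it. So the cardinalities add up. *)
pose S0 := deep delta y.
pose S1 : {set 'I_k} := [set i : 'I_k | (i : nat) \in map half t]%SET.
have S1P c : c \in t -> exists p (i : 'I_k), [/\ p \in s, c./2 = i :> nat & i \in deep delta (signed b (horizontal p))].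
  move=> ct; have [oc _] := tP _ ct.
  have [p ps Ec] : exists2 p, p \in s & c = lab p by apply: lab_mem; rewrite El inE tl ?orbT.
  have ub : upper delta p = b by rewrite -odd_lab -Ec.
  have [|i ip Ei] := @top_indexP _ (deep delta (signed b (horizontal p))).
    exact: leq_trans n0 (deep_nonempty deltaP _ (s1 p ps) (height2 p ps)).
  by exists p, i; split=> //; rewrite Ec half_lab -Ei /signed_index ub.
have S0n : (n <= #|S0|)%N := deep_nonempty deltaP _ (s1 pa pas) (height2 pa pas).
have S1n : #|S1| = (d.+1 %/ 2)%N.
  rewrite /S1 card_set_of_nats; first by rewrite size_map st /= szl divn2.
    rewrite map_inj_in_uniq // => c c' /tP[oc _] /tP[oc' _] E.
    by rewrite -(odd_double_half c) -(odd_double_half c') oc oc' E.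
  by move=> _ /mapP[c /S1P[p [i [_ -> _]]] ->].
have S01 : (S0 :&: S1 = finset.set0)%SET.
  apply/setP => i; rewrite !inE; apply/negP => /andP[i0].
  case/mapP => c ct Ei; have [oc ac] := tP c ct.
  have : (i <= a./2)%N.
    rewrite Ea half_lab /signed_index oa -/y; apply: (@leq_bigmax_cond _ _ (fun i : 'I_k => i : nat)).
    by rewrite inE.
  by rewrite Ei leqNgt ltn_half_odd // oc Ea odd_lab oa.
have Scone i : i \in S0 :|: S1 -> cone i y.
  rewrite finset.in_setU => /orP[i0|]; first exact: cone_y pas i0.
  rewrite inE => /mapP[c /S1P[p [j [ps Ej jp]]] Ei].
  by rewrite (_ : i = j); [exact: cone_y jp|apply: val_inj; rewrite /= Ei Ej].
have Sn : (d.+1 %/ 2 + n <= #|S0 :|: S1|)%N.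
  by rewrite cardsU S01 cards0 subn0 S1n addnC leq_add2r.
have [i iS] : exists i, i \in S0 :|: S1.
  by apply/card_gt0P; apply: leq_trans Sn; rewrite addn_gt0 n0 orbT.
exists (normalize y); split.
  by apply: sqsum_normalize; case: (Scone i iS).
by exists (S0 :|: S1)%SET; split=> // j /Scone[].
Qed.

End LowerBound.

(** * Gale's theorem and the upper bound *)

Section WeakAlternation.
Local Open Scope ring_scope.
Variable R : rcfType.
Implicit Types (p q : {poly R}) (s : seq R).

Fixpoint weakly_alternating p b s :=
  if s is t :: s' then (0 <= (-1) ^+ nat_of_bool b * p.[t]) && weakly_alternating p (~~ b) s'
  else true.

Lemma weakly_alternating_factor q c b s : (forall t, t \in s -> c < t) ->
  weakly_alternating (q * ('X - c%:P)) b s = weakly_alternating q b s.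
Proof.
elim: s b => //= t s ih b cs; rewrite ih => [|u us]; last by apply: cs; rewrite inE us orbT.
by rewrite hornerM hornerXsubC mulrA pmulr_lge0 // subr_gt0 cs ?inE ?eqxx.
Qed.

(* Divide by a root in [[t0, t1]]: this drops the node [t0] if the root lies to
   the left of [t1], and the node [t1] if the root is [t1] itself. *)
Lemma weakly_alternating_eq0 p b s : sorted <%R s -> (size p < size s)%N ->
  weakly_alternating p b s -> p = 0.
Proof.
have [n] := ubnP (size s); elim: n p b s => // n ih p b [|t0 [|t1 s]] sn //.
  by rewrite ltnS leqn0 size_poly_eq0 => _ /eqP.
move=> ss ps /= /and3P[p0 p1 pa].
have [t01 ss1] : t0 < t1 /\ sorted <%R (t1 :: s) by case/andP: ss.
have gt1 t : t \in s -> t1 < t.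
  by move: ss1 => /=; rewrite (path_sortedE lt_trans) => /andP[/allP h _] /h.
have reduce q c b' s' : p = q * ('X - c%:P) -> (size s' < n)%N ->
    size s' = (size s).+1 -> sorted <%R s' -> weakly_alternating q b' s' -> p = 0.
  move=> pE s'n s's s's' qa; have [q0|q0] := eqVneq q 0; first by rewrite pE q0 mul0r.
  move: ps; rewrite pE size_Mmonic ?monicXsubC // size_XsubC addn2 /= ltnS => qs.
  by move: q0; rewrite (ih q b' s') ?eqxx // s's.
have [pt1|pt1] := eqVneq p.[t1] 0.
  have [q pE] : exists q, p = q * ('X - t1%:P) by apply/factor_theorem/eqP.
  (* At [t0] the factor is negative, so [q] has there the sign [~~ b], as the dropped node [t1] had;
     the pattern continues into [s]. *)
  apply: (reduce q t1 (~~ b) (t0 :: s)) => //.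
    move: ss1 => /=; rewrite !(path_sortedE lt_trans) => /andP[_ ->]; rewrite andbT.
    by apply/allP => t /gt1; apply: lt_trans.
  rewrite /= negbK -(weakly_alternating_factor q b gt1) -pE.
  move: pa; rewrite negbK => ->; rewrite andbT.
  move: p0; rewrite pE hornerM hornerXsubC mulrA nmulr_lge0 ?subr_lt0 //.
  by case: (b) => /=; rewrite ?expr0 ?expr1 ?mul1r ?mulN1r ?oppr_le0 ?oppr_ge0.
have [c /andP[c0 c1] rc] : exists2 c, t0 <= c <= t1 & root ((-1) ^+ nat_of_bool (~~ b) *: p) c.
  apply: poly_ivt; first exact: ltW.
  rewrite !hornerZ p1 andbT; move: p0.
  by case: (b) => /=; rewrite ?expr0 ?expr1 ?mul1r ?mulN1r ?oppr_le0 ?oppr_ge0.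
rewrite rootZ ?signr_eq0 // in rc.
have ct1 : c < t1.
  by rewrite lt_neqAle c1 andbT; apply: contraNneq pt1 => <-.
have [q pE] : exists q, p = q * ('X - c%:P) by apply/factor_theorem.
apply: (reduce q c (~~ b) (t1 :: s)) => //.
rewrite -(@weakly_alternating_factor q c) -?pE /= ?p1 // => t.
by rewrite inE => /orP[/eqP->//|/gt1]; apply: lt_trans.
Qed.

End WeakAlternation.

(* Each index violating [B] costs at most itself and the next index. *)
Lemma alternating_selection (B : pred nat) a m : exists t,
  [/\ subseq t (iota a m), all B t, alternating (odd a) (map odd t) &
      (m <= size t + 2 * count (predC B) (iota a m))%N].
Proof.
have [n] := ubnP m; elim: n a m => // n ih a [|[|m]] mn.
- by exists [::].
- case: (boolP (B a)) => Ba; [exists [:: a]|exists [::]]; split=> //=.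
  + by rewrite eqxx.
  + by rewrite Ba.
  + by rewrite eqxx.
  + by rewrite Ba.
- case: (boolP (B a)) => Ba.
    have [|t [st Bt at_ mt]] := ih a.+1 m.+1; first by lia.
    exists (a :: t); split=> //=.
    + by rewrite eqxx; exact: st.
    + by rewrite Ba.
    + by rewrite eqxx.
    + by rewrite Ba; move: mt => /=; lia.
  have [|t [st Bt at_ mt]] := ih a.+2 m; first by lia.
  exists t; split=> //.
  + by apply: subseq_trans st _; exact: (suffix_subseq [:: a; a.+1]).
  + by rewrite -[odd a]negbK.
  + by move: mt; rewrite /= Ba; lia.
Qed.

Section Gale.
Local Open Scope ring_scope.
Variable R : rcfType.
Implicit Types p : {poly R}.

(** With at most [n - 1] good indices, [alternating_selection] applied to the bad ones leaves at
    least [2n + d - 2(n - 1) = d + 2] of alternating parity, where [p] alternates weakly; so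
    [p = 0]. *)
Lemma gale d n p : p != 0 -> (size p <= d.+1)%N ->
  (n <= count (fun i => (0 < (-1) ^+ i * p.[i%:R])%R) (iota 0 (2 * n + d)))%N.
Proof.
move=> p0 pd; rewrite leqNgt; apply: contraNN p0 => few; apply/eqP.
set good := fun i : nat => _ in few.
have [t [st Bt at_ mt]] := alternating_selection (predC good) 0 (2 * n + d).
(* The sign starts at [true] because at a bad even index [p] is at most 0. *)
apply: (@weakly_alternating_eq0 _ p true (map (fun i => i%:R) t)).
- rewrite sorted_map; apply: (@sub_sorted _ ltn).
    by move=> i j /= ij; rewrite ltr_nat.
  by apply: subseq_sorted st (iota_ltn_sorted _ _); exact: ltn_trans.
- rewrite size_map; apply: leq_ltn_trans pd _.
  have E : count (predC (predC good)) (iota 0 (2 * n + d)) = count good (iota 0 (2 * n + d)).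
    by apply: eq_count => i /=; rewrite negbK.
  move: mt few; rewrite E; move: (count good _) (size t) => g m; clear => mt gn. lia.
- rewrite [odd 0]/= in at_; rewrite -[true]/(~~ false).
  elim: t (false) Bt at_ {st mt} => //= i t ih b /andP[gi Bt] /andP[/eqP ib at_].
  rewrite ih // andbT; move: gi; rewrite /good -leNgt -signr_odd ib.
  by case: (b); rewrite ?expr0 ?expr1 ?mul1r ?mulN1r ?oppr_le0 ?oppr_ge0.
Qed.

End Gale.

(** * The cover by open hemispheres along the moment curve *)

Section UpperBound.
Local Open Scope ring_scope.
Notation R := Rdefinitions.R.
Variables (d n : nat).

Definition gale_form (i : nat) (x : pt d) : R := (-1) ^+ i * (rVpoly x).[i%:R].

Definition gale_set (i : 'I_(2 * n + d)) (x : pt d) : Prop :=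
  on_sphere x /\ 0 < gale_form i x.

Definition gale_indices (x : pt d) : {set 'I_(2 * n + d)} :=
  [set i : 'I_(2 * n + d) | 0 < gale_form i x].

Lemma gale_formN i x : gale_form i (- x) = - gale_form i x.
Proof. by rewrite /gale_form linearN hornerN mulrN. Qed.

Lemma on_sphereN x : @on_sphere d x -> on_sphere (- x).
Proof. by rewrite /on_sphere /sqnorm => <-; apply: eq_bigr => j _; rewrite mxE sqrrN. Qed.

Lemma gale_form_coord i x :
  gale_form i x = \sum_j x 0 j * ((-1) ^+ i * i%:R ^+ j).
Proof.
rewrite /gale_form (@horner_coef_wide _ d.+1); last exact: size_poly.
by rewrite mulr_sumr; apply: eq_bigr => j _; rewrite coef_rVpoly_ord mulrCA.
Qed.

Lemma gale_form_open i x : 0 < gale_form i x -> exists e : R, 0 < e /\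
  forall y, sqnorm (y - x) < e -> 0 < gale_form i y.
Proof.
move=> Lx; pose w (j : 'I_d.+1) : R := (-1) ^+ i * i%:R ^+ j.
(* The summand 1 leaves a margin: moving each coordinate by at most [r] changes the form by at most
   [r * (W - 1)], which is its value at [x] minus [r]. *)
pose W := 1 + \sum_j `|w j|.
have W0 : 0 < W by rewrite ltr_pwDl // sumr_ge0.
pose r := gale_form i x / W.
have r0 : 0 < r by rewrite divr_gt0.
exists (r ^+ 2); split=> [|y yx]; first by rewrite exprn_gt0.
have coord j : `|(y - x) 0 j| <= r.
  have : (y - x) 0 j ^+ 2 < r ^+ 2.
    apply: le_lt_trans yx; rewrite /sqnorm (bigD1 j) //= lerDl.
    by apply: sumr_ge0 => k _; exact: sqr_ge0.
  by rewrite ler_norml; move: ((y - x) 0 j) => z zr; apply/andP; split; nra.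
have -> : gale_form i y = gale_form i x + gale_form i (y - x).
  by rewrite -mulrDr -hornerD -linearD addrC subrK.
have : `|gale_form i (y - x)| <= r * \sum_j `|w j|.
  rewrite gale_form_coord mulr_sumr; apply: le_trans (ler_norm_sum _ _ _) _.
  by apply: ler_sum => j _; rewrite normrM ler_wpM2r.
have -> : r * \sum_j `|w j| = gale_form i x - r.
  by rewrite -[\sum_j _](addKr 1) -/W mulrDr mulrN1 addrC divfK // gt_eqF.
by rewrite ler_norml; lra.
Qed.

Lemma gale_indices_card x : on_sphere x -> (n <= #|gale_indices x|)%N.
Proof.
move=> x1; have x0 : rVpoly x != 0.
  apply/eqP => x0; have := x1; rewrite /on_sphere -(rVpolyK x) x0 linear0 /sqnorm.
  rewrite big1 => [/esym/eqP|j _]; first by rewrite oner_eq0.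
  by rewrite mxE expr0n.
apply: leq_trans (gale n x0 (size_poly _ _)) _.
rewrite -sum1_card (eq_bigl (fun i : 'I__ => 0 < gale_form i x)); last first.
  by move=> i; rewrite inE.
by rewrite -(big_mkord (fun i => 0 < gale_form i x) (fun=> 1%N)) sum1_count /index_iota subn0.
Qed.

Lemma gale_cover : antipodal_open_nfold_cover n gale_set.
Proof.
split; [|split] => [i|i x [[_ Lx] [_]]|x x1].
- split=> [x []//|x [x1 /gale_form_open[e [e0 eP]]]].
  by exists e; split=> // y y1 /eP.
- by rewrite gale_formN oppr_gt0 ltNge (ltW Lx).
- exists (gale_indices x); split; first exact: gale_indices_card.
  by move=> i; rewrite inE.
Qed.

Lemma gale_multiplicity x q :
  on_sphere x -> covered_at_least gale_set x q -> (q <= d + n)%N.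
Proof.
move=> x1 [S [qS SU]]; apply: leq_trans qS _.
have S0 : (S :&: gale_indices (- x) = finset.set0)%SET.
  apply/setP => i; rewrite !inE gale_formN oppr_gt0; apply/negP => /andP[/SU[_ Lx]].
  by rewrite ltNge ltW.
have := max_card (mem (S :|: gale_indices (- x))).
rewrite cardsU S0 cards0 subn0 card_ord.
by have := gale_indices_card (on_sphereN x1); clear; lia.
Qed.

End UpperBound.

Theorem theorem2 (d n : nat) (hd : (1 <= d)%N) (hn : (1 <= n)%N) :
  (exists q, is_Q d n q) /\
  (forall q, is_Q d n q -> ((d.+1) %/ 2 + n <= q <= d + n)%N).
Proof.
(* [d.+1 %/ 2] is the ceiling of [d / 2]. *)
have lower : forces_multiplicity d n (d.+1 %/ 2 + n).
  by move=> k U; exact: covered_lower_bound.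
have upper q : forces_multiplicity d n q -> (q <= d + n)%N.
  move=> /(_ _ _ (@gale_cover d n))[x [x1 xq]]; exact: gale_multiplicity x1 xq.
split=> [|q [fq maxq]]; last by rewrite maxq //= upper.
pose P q := `[< forces_multiplicity d n q >].
have exP : exists q, P q by exists (d.+1 %/ 2 + n); apply/asboolP.
have ubP q : P q -> (q <= d + n)%N by move/asboolP/upper.
have [q /asboolP fq maxq] := ex_maxnP exP ubP.
by exists q; split=> // q' /asboolP; exact: maxq.
Qed.
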